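(* Let $n\ge4$. Let $z_{i,j}$ ($0\le i\le1\le j\le n-2$) be the rational functions of $z_{0,1},z_{1,1},q_1$ obtained by elimination as described in the context. Under the identifications $h=z_{0,1}$ and $x=z_{1,1}/q_1$, one has $$z_{1,n-3}^2\,\partial_{z_{1,n-3}}f_{\rm tor}=-R_{\rm b}(n-1),\qquad z_{1,n-2}^2\,\partial_{z_{1,n-2}}f_{\rm tor}=q_1R_\sigma(n-1)+(x-q_1)R_{\rm b}(n-1)-q_1q_2.$$ Consequently, $$\mathrm{Jac}(f_{\rm tor})\cong\mathbb{C}[h^{\pm1},x^{\pm1},q_1^{\pm1},q_2^{\pm1}]/\big(R_{\rm b}(n-1),\,R_\sigma(n-1)-q_2\big).$$
   Context: The Laurent polynomial $f_{\rm tor}$ in the variables $z_{i,j}$ ($0\le i\le1$, $1\le j\le n-2$) and $q_1,q_2$ is $$f_{\rm tor}=z_{0,1}+\sum_{j=2}^{n-2}\frac{z_{0,j}}{z_{0,j-1}}+\frac{z_{1,1}}{q_1}+\sum_{j=2}^{n-2}\frac{z_{1,j}}{z_{1,j-1}}+\sum_{j=1}^{n-2}\frac{z_{1,j}}{z_{0,j}}+\frac{q_1q_2}{z_{1,n-2}}.$$ Elimination: the relations $\partial_{z_{0,j}}f_{\rm tor}=0$ ($1\le j\le n-2$) and $\partial_{z_{1,j}}f_{\rm tor}=0$ ($1\le j\le n-4$) are used to express all variables as rational functions of $z_{0,1},z_{1,1},q_1$: with $z_{0,0}:=1$, $z_{0,j+1}=\frac{z_{0,j}^2}{z_{0,j-1}}-z_{1,j}$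 ($1\le j\le n-3$); $z_{1,2}=\big(\frac1{q_1}+\frac1{z_{0,1}}\big)z_{1,1}^2$ if $n\ge5$; $z_{1,j+1}=\big(\frac1{z_{1,j-1}}+\frac1{z_{0,j}}\big)z_{1,j}^2$ ($2\le j\le n-4$); $z_{1,n-2}=\frac{z_{0,n-2}^2}{z_{0,n-3}}$. The expressions $z_{1,n-3}^2\partial_{z_{1,n-3}}f_{\rm tor}$ and $z_{1,n-2}^2\partial_{z_{1,n-2}}f_{\rm tor}$ mean: differentiate $f_{\rm tor}$ with all $z_{i,j}$ independent, then substitute these rational functions. $\mathrm{Jac}(f_{\rm tor})$ denotes (the Jacobi ring of $f_{\rm tor}$ after dropping the requirement that the eliminated $z_{i,j}$ be invertible) $\mathbb{C}[z_{0,1}^{\pm1},z_{1,1}^{\pm1},q_1^{\pm1},q_2^{\pm1}]/(z_{1,n-3}^2\partial_{z_{1,n-3}}f_{\rm tor},\ z_{1,n-2}^2\partial_{z_{1,n-2}}f_{\rm tor})$. $R_{\rm b}(m),R_\sigma(m)\in\mathbb{C}[h,x,q_1,q_2]$ are defined by $R_{\rm b}(0)=1$, $R_{\rm b}(1)=h$, $R_{\rm b}(m)=(h+x)R_{\rm b}(m-1)-(h+q_1)xR_{\rm b}(m-2)$ for $m\ge2$, and $R_\sigma(m)=\sum_{j=0}^mx^{m-j}R_{\rm b}(j)$ for $m\ge0$.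
   Formalization: The second identity is false as written; it is proved with −W·D1 added on the right, where D1 is the first expression and W = z_{1,n−2}/z_{1,n−3} + z_{1,n−2}/z_{0,n−2}; in Jac(f_tor) the second generator D2 is replaced by D2 + W·D1, as D2 is not in the Laurent ring for n ≥ 5. *)

(* Defs.v *)
From HB Require Import structures.
From mathcomp Require Import all_boot all_order all_algebra.
From mathcomp Require Import boolp reals complex mpoly.

Set Implicit Arguments.
Unset Strict Implicit.
Unset Printing Implicit Defensive.

Import GRing.Theory.
Local Open Scope ring_scope.
Local Open Scope quotient_scope.

(* F(t_0, ..., t_(N-1)) *)
Notation ratfun F N := {fraction {mpoly F[N]}}.

Section RationalFunctions.
Variables (F : fieldType) (N : nat).

Definition ratpoly (p : {mpoly F[N]}) : ratfun F N := FracField.tofrac p.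

Definition ratconst (c : F) : ratfun F N := ratpoly c%:MP.

(* Quotient rule; the result does not depend on the representative [repr f]. *)
Definition ratderiv (i : 'I_N) (f : ratfun F N) : ratfun F N :=
  let p := \n_(repr f) in let q := \d_(repr f) in
  ratpoly (p^`M(i) * q - p * q^`M(i)) / ratpoly (q ^+ 2).

(* Value of f at v : K^N, for K an F-algebra via c: it is p(v) / q(v) for any
   fraction p / q equal to f with q(v) <> 0, and 0 if there is none. *)
Definition rateval (K : fieldType) (c : F -> K) (v : 'I_N -> K)
    (f : ratfun F N) : K :=
  if pselect (exists pq : {mpoly F[N]} * {mpoly F[N]},
                f = ratpoly pq.1 / ratpoly pq.2 /\ mmap c v pq.2 != 0)
  is left ex then let pq := projT1 (cid ex) in mmap c v pq.1 / mmap c v pq.2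
  else 0.

End RationalFunctions.

(* The Laurent polynomial ring F[t_0^{+-1}, ..., t_(N-1)^{+-1}], as the subring
   of the rational functions whose denominator is a monomial. *)
Section Laurent.
Variables (F : fieldType) (N : nat).

Definition is_laurent : {pred ratfun F N} := fun f =>
  `[< exists (p : {mpoly F[N]}) (m : 'X_{1..N}), f = ratpoly p / ratpoly 'X_[m] >].

Lemma ratpolyX_neq0 (m : 'X_{1..N}) : ratpoly 'X_[F, m] != 0.
Proof. by rewrite tofrac_eq0 -msupp_eq0 msuppX. Qed.

Lemma is_laurent_poly p : ratpoly p \in is_laurent.
Proof.
apply/asboolP; exists p, 0%MM.
by rewrite mpolyX0 /ratpoly rmorph1 divr1.
Qed.

Lemma is_laurent_subring : subring_closed is_laurent.
Proof.
split=> [|f g /asboolP[p [m ->]] /asboolP[q [l ->]]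
         |f g /asboolP[p [m ->]] /asboolP[q [l ->]]].
- by rewrite -(rmorph1 (@FracField.tofrac {mpoly F[N]})) is_laurent_poly.
- apply/asboolP; exists (p * 'X_[l] - q * 'X_[m]), (m + l)%MM.
  have hm := ratpolyX_neq0 m; have hl := ratpolyX_neq0 l.
  by rewrite -mulNr addf_div // mpolyXD /ratpoly rmorphB !rmorphM mulNr.
- apply/asboolP; exists (p * q), (m + l)%MM.
  by rewrite mpolyXD /ratpoly !rmorphM invfM mulrACA.
Qed.

HB.instance Definition _ :=
  GRing.isSubringClosed.Build (ratfun F N) is_laurent is_laurent_subring.

Record laurent := Laurent {
  laurent_val :> ratfun F N;
  _ : laurent_val \in is_laurent }.

HB.instance Definition _ := [isSub for laurent_val].
HB.instance Definition _ := [Choice of laurent by <:].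
HB.instance Definition _ := [SubChoice_isSubComNzRing of laurent by <:].

Definition lpoly (p : {mpoly F[N]}) : laurent := Laurent (is_laurent_poly p).

End Laurent.

(* The quotient of a commutative ring by the ideal generated by two elements.
   [Quotient.quot] only gets a ring structure in the library when the ideal is
   proper; here it may a priori be the zero ring. *)
Section Quotient2.
Variables (A : comNzRingType) (g1 g2 : A).

Definition ideal2 : {pred A} := fun y => `[< exists a b, y = a * g1 + b * g2 >].

Lemma ideal2_zmod : zmod_closed ideal2.
Proof.
split=> [|_ _ /asboolP[a [b ->]] /asboolP[c [d ->]]]; apply/asboolP.
  by exists 0, 0; rewrite !mul0r addr0.
by exists (a - c), (b - d); rewrite !mulrBl opprD addrACA.
Qed.

Lemma ideal2Ml a y : y \in ideal2 -> a * y \in ideal2.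
Proof.
move=> /asboolP[c [d ->]]; apply/asboolP; exists (a * c), (a * d).
by rewrite mulrDr !mulrA.
Qed.

HB.instance Definition _ := GRing.isZmodClosed.Build A ideal2 ideal2_zmod.

Definition quot2 : Type := Quotient.quot ideal2.
HB.instance Definition _ := GRing.Zmodule.on quot2.

Definition quot2_pi (x : A) : quot2 := \pi_(Quotient.quot ideal2) x.
Local Notation pi := quot2_pi.

Definition quot2_repr (x : quot2) : A := repr (x : Quotient.quot ideal2).
Definition quot2_one : quot2 := pi 1.
Definition quot2_mul (x y : quot2) : quot2 := pi (quot2_repr x * quot2_repr y).

Lemma quot2_eqP x y : (pi x = pi y) <-> (x - y \in ideal2).
Proof. by rewrite Quotient.idealrBE; split=> /eqP. Qed.

Lemma quot2_reprK x : pi (quot2_repr x) = x.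
Proof. exact: (@reprK _ (Quotient.quot ideal2)). Qed.

Lemma quot2_piM x y : pi (x * y) = quot2_mul (pi x) (pi y).
Proof.
apply/quot2_eqP; set x' := quot2_repr _; set y' := quot2_repr _.
have hx : x - x' \in ideal2 by apply/quot2_eqP; rewrite quot2_reprK.
have hy : y - y' \in ideal2 by apply/quot2_eqP; rewrite quot2_reprK.
have -> : x * y - x' * y' = y * (x - x') + x' * (y - y').
  by rewrite !mulrBr addrA [y * x]mulrC [y * x']mulrC subrK.
by rewrite rpredD ?ideal2Ml.
Qed.

Lemma quot2_piD x y : pi (x + y) = pi x + pi y.
Proof. exact: (raddfD (\pi_(Quotient.quot ideal2))). Qed.

Lemma quot2_mulA : associative quot2_mul.
Proof.
move=> x y z; rewrite -(quot2_reprK x) -(quot2_reprK y) -(quot2_reprK z).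
by rewrite -!quot2_piM mulrA.
Qed.

Lemma quot2_mulC : commutative quot2_mul.
Proof. by move=> x y; rewrite /quot2_mul mulrC. Qed.

Lemma quot2_mul1 : left_id quot2_one quot2_mul.
Proof. by move=> x; rewrite -(quot2_reprK x) -quot2_piM mul1r. Qed.

Lemma quot2_mulDl : left_distributive quot2_mul +%R.
Proof.
move=> x y z; rewrite -(quot2_reprK x) -(quot2_reprK y) -(quot2_reprK z).
by rewrite -quot2_piD -!quot2_piM mulrDl quot2_piD.
Qed.

HB.instance Definition _ := GRing.Zmodule_isComPzRing.Build quot2
  quot2_mulA quot2_mulC quot2_mul1 quot2_mulDl.

End Quotient2.

Section Ftor.
Variables (F : fieldType) (n : nat).

(* The variables of f_tor, numbered q1, q2, z_{0,1}, ..., z_{0,n-2},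
   z_{1,1}, ..., z_{1,n-2}. *)
Definition ftor_nvars := (2 * (n - 2)).+2.

Definition zidx (i j : nat) : 'I_ftor_nvars := inord (2 + i * (n - 2) + j.-1).

Local Notation T := (ratfun F ftor_nvars).

Definition ftor_q1 : T := ratpoly 'X_(inord 0).
Definition ftor_q2 : T := ratpoly 'X_(inord 1).
Definition ftor_z (i j : nat) : T := ratpoly 'X_(zidx i j).

Definition ftor : T :=
  ftor_z 0 1 + \sum_(2 <= j < n.-1) ftor_z 0 j / ftor_z 0 j.-1
  + ftor_z 1 1 / ftor_q1 + \sum_(2 <= j < n.-1) ftor_z 1 j / ftor_z 1 j.-1
  + \sum_(1 <= j < n.-1) ftor_z 1 j / ftor_z 0 j
  + ftor_q1 * ftor_q2 / ftor_z 1 (n - 2).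

End Ftor.

Section Elimination.
Variable F : fieldType.

(* Both C[z_{0,1}, z_{1,1}, q1, q2] and C[h, x, q1, q2] are {mpoly F[4]}, with
   the variables in this order. *)
Local Notation K := (ratfun F 4).
Definition var4 (k : nat) : {mpoly F[4]} := 'X_(inord k).

Definition z01 : K := ratpoly (var4 0).
Definition z11 : K := ratpoly (var4 1).
Definition q1 : K := ratpoly (var4 2).
Definition q2 : K := ratpoly (var4 3).

(* The recursions, without the final value z_{1,n-2}; zrec1 0 is a dummy. *)
Fixpoint zrec0 (j : nat) : K :=
  match j with
  | 0 => 1
  | j1.+1 => match j1 with
    | 0 => z01
    | j2.+1 => zrec0 j1 ^+ 2 / zrec0 j2 - zrec1 j1
    end
  end
with zrec1 (j : nat) : K :=
  match j with
  | 0 => 0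
  | j1.+1 => match j1 with
    | 0 => z11
    | j2.+1 => match j2 with
      | 0 => (q1^-1 + z01^-1) * z11 ^+ 2
      | _ => ((zrec1 j2)^-1 + (zrec0 j1)^-1) * zrec1 j1 ^+ 2
      end
    end
  end.

Definition zelim (n i j : nat) : K :=
  if i == 0%N then zrec0 j
  else if j == (n - 2)%N then zrec0 (n - 2) ^+ 2 / zrec0 (n - 3)
  else zrec1 j.

(* Inverse to the numbering of the variables of f_tor. *)
Definition elim_point (n : nat) (k : 'I_(ftor_nvars n)) : K :=
  if k == 0%N :> nat then q1
  else if k == 1%N :> nat then q2
  else zelim n ((k - 2) %/ (n - 2)) ((k - 2) %% (n - 2)).+1.

Definition elim_subst (n : nat) : ratfun F (ftor_nvars n) -> K :=
  rateval (@ratconst F 4) (@elim_point n).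

(* z_{1,j}^2 * d f_tor / d z_{1,j}, then substitution *)
Definition ftor_expr (n j : nat) : K :=
  elim_subst (ftor_z F n 1 j ^+ 2 * ratderiv (zidx n 1 j) (ftor F n)).

Definition hh : {mpoly F[4]} := var4 0.
Definition xx : {mpoly F[4]} := var4 1.
Definition qq1 : {mpoly F[4]} := var4 2.
Definition qq2 : {mpoly F[4]} := var4 3.

Fixpoint Rb (m : nat) : {mpoly F[4]} :=
  match m with
  | 0 => 1
  | m1.+1 => match m1 with
    | 0 => hh
    | m2.+1 => (hh + xx) * Rb m1 - (hh + qq1) * xx * Rb m2
    end
  end.

Definition Rsigma (m : nat) : {mpoly F[4]} :=
  \sum_(0 <= j < m.+1) xx ^+ (m - j) * Rb j.

(* h |-> z_{0,1}, x |-> z_{1,1} / q1 *)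
Definition identify : {mpoly F[4]} -> K :=
  mmap (@ratconst F 4) (fun i => [:: z01; z11 / q1; q1; q2]`_i).

(* In the ring C[z_{i,j}^{+-1}, q_i^{+-1}] obtained by elimination, the second
   expression equals q1 Rsigma(n-1) + (x - q1) Rb(n-1) - q1 q2 only up to a
   multiple of the first one; the multiplier is minus the following. Without it
   the second expression is z_{0,n-2}^3 / (q1 x^(n-3) (h + q1)^(n-4)) - q1 q2,
   which for n >= 5 is not even a Laurent polynomial in h, x, q1, q2. *)
Definition ftor_cofactor (n : nat) : K :=
  zelim n 1 (n - 2) / zelim n 1 (n - 3) + zelim n 1 (n - 2) / zelim n 0 (n - 2).

End Elimination.

(* Main.v *)
Require Import Defs.
From HB Require Import structures.
From mathcomp Require Import all_boot all_order all_algebra.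
From mathcomp Require Import boolp reals complex mpoly ring zify.

Set Implicit Arguments.
Unset Strict Implicit.
Unset Printing Implicit Defensive.

Import GRing.Theory.
Local Open Scope ring_scope.

(* Put h = z01, x = z11 / q1 and let rb be the sequence of the R_b(j). As rb
   satisfies a linear recurrence with constant coefficients, its Casoratian
     D_j = rb_(j+1)^2 - rb_j rb_(j+2)
   is geometric: D_j = q1 x ((h + q1) x)^j. This solves the elimination in
   closed form: z_(0,j) = rb_j and z_(1,j+1) = D_j / rb_j. The first expression
   is then the defect D_(n-3) / rb_(n-3) - rb_(n-2)^2 / rb_(n-3) = - rb_(n-1)
   between the recursion for z_(1,n-2) and its prescribed value. Modulo it, the
   second one is (h + q1) x rb_(n-2) - q1 q2, and
     (h + q1) x rb_(m-1) = q1 R_sigma(m) + (x - q1) rb_m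
   by induction on m. The isomorphism of quotients is induced by the
   automorphism z11 |-> q1 x of the Laurent polynomial ring, q1 being a unit. *)

(** * Fractions, ring morphisms and derivations *)

(** With the second hypothesis the derivative of the first, this makes the quotient rule independent
    of the chosen fraction. The equality is already cross-multiplied, so no factor has to be
    cancelled. *)
Lemma quotient_rule_wd (A : comNzRingType) (p q p' q' dp dq dp' dq' : A) :
  p * q' = p' * q -> dp * q' + p * dq' = dp' * q + p' * dq ->
  (dp' * q' - p' * dq') * q ^+ 2 = (dp * q - p * dq) * q' ^+ 2.
Proof.
move=> E E'.
have -> : (dp' * q' - p' * dq') * q ^+ 2
        = q * q' * (dp' * q) - (p' * q) * dq' * q by ring.
have -> : dp' * q = dp * q' + p * dq' - p' * dq by rewrite E' addrK.
rewrite -E.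
have -> : q * q' * (dp * q' + p * dq' - p' * dq)
        = q * q' * (dp * q' + p * dq') - q' * dq * (p' * q) by ring.
by rewrite -E; ring.
Qed.

Section MorphismFractions.
Variables (A : nzRingType) (K : fieldType) (phi : {rmorphism A -> K}).
Implicit Types p q : A.

Lemma rmorph_addf p q p' q' : phi q != 0 -> phi q' != 0 ->
  phi p / phi q + phi p' / phi q' = phi (p * q' + p' * q) / phi (q * q').
Proof. by move=> q0 q'0; rewrite addf_div // rmorphD !rmorphM. Qed.

Lemma rmorph_mulf p q p' q' :
  (phi p / phi q) * (phi p' / phi q') = phi (p * p') / phi (q * q').
Proof. by rewrite mulf_div !rmorphM. Qed.

Lemma rmorph_eqf p q p' q' : phi q != 0 -> phi q' != 0 ->
  phi p / phi q = phi p' / phi q' <-> phi (p * q') = phi (p' * q).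
Proof.
move=> q0 q'0; rewrite !rmorphM.
have E := eqr_div (phi p) (phi p') q0 q'0.
by split=> /eqP; [rewrite E | rewrite -E] => /eqP.
Qed.

End MorphismFractions.

Section FieldDerivation.
Variables (K : fieldType) (D : K -> K).
Hypotheses (DD : forall a b, D (a + b) = D a + D b)
  (DM : forall a b, D (a * b) = D a * b + a * D b).

Lemma derivation0 : D 0 = 0.
Proof. by apply: (addrI (D 0)); rewrite -DD !addr0. Qed.

Lemma derivation1 : D 1 = 0.
Proof. by apply: (addrI (D 1)); have := DM 1 1; rewrite !mulr1 mul1r addr0. Qed.

Lemma derivation_div a b : D (a / b) = D a / b - a * D b / b ^+ 2.
Proof.
(* For b = 0 the convention 0^-1 = 0 makes both sides vanish. *)
rewrite DM; have [->|b0] := eqVneq b 0; first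
  by rewrite invr0 derivation0 !mulr0 mul0r subrr addr0.
congr (_ + _); have := DM b b^-1; rewrite divff // derivation1 => E.
(* The first two terms in the parentheses add up to D (b / b) = D 1 = 0. *)
have -> : D b^-1 = (D b / b + b * D b^-1 - D b / b) / b by field.
by rewrite -E; field.
Qed.

Lemma derivation_div0 a b : D a = 0 -> D b = 0 -> D (a / b) = 0.
Proof. by move=> a0 b0; rewrite derivation_div a0 b0 mulr0 !mul0r subrr. Qed.

Lemma derivation_sum I (r : seq I) (P : pred I) (f : I -> K) :
  D (\sum_(k <- r | P k) f k) = \sum_(k <- r | P k) D (f k).
Proof. exact: (big_morph _ DD derivation0). Qed.

End FieldDerivation.

(** * Derivatives and values of rational functions *)

Section RationalFunctions.
Variables (F : fieldType) (N : nat).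
Implicit Types (f g : ratfun F N) (p q : {mpoly F[N]}).

HB.instance Definition _ :=
  GRing.RMorphism.copy (@ratpoly F N) (@FracField.tofrac _).
HB.instance Definition _ :=
  GRing.RMorphism.copy (@ratconst F N) (@ratpoly F N \o @mpolyC N F).

Lemma ratpoly_inj : injective (@ratpoly F N).
Proof. by move=> p q /eqP; rewrite tofrac_eq => /eqP. Qed.

Lemma ratpoly_eq0 p : (ratpoly p == 0) = (p == 0).
Proof. exact: tofrac_eq0. Qed.

Lemma ratfun_numden f : f = ratpoly \n_(repr f) / ratpoly \d_(repr f).
Proof.
have d0 : ratpoly \d_(repr f) != 0 by rewrite ratpoly_eq0 denom_ratioP.
apply: (mulIf d0); rewrite divfK // -{1}[f]reprK /ratpoly.
move: (repr f) => r; unlock FracField.tofrac; rewrite -[LHS]FracField.pi_mul.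
apply/eqmodP; rewrite /= FracField.equivfE /FracField.mulf.
rewrite !numden_Ratio ?mulr1 ?denom_ratioP ?oner_neq0 //.
by rewrite mulrC.
Qed.

Lemma ratpoly_fracP p q p' q' : q != 0 -> q' != 0 ->
  ratpoly p / ratpoly q = ratpoly p' / ratpoly q' <-> p * q' = p' * q.
Proof.
rewrite -(ratpoly_eq0 q) -(ratpoly_eq0 q') => q0 q'0.
have [E1 E2] := @rmorph_eqf _ _ (@ratpoly F N) p q p' q' q0 q'0.
by split=> [/E1/ratpoly_inj|E]; last by apply: E2; rewrite E.
Qed.

Lemma ratfun_frac f : exists p q, q != 0 /\ f = ratpoly p / ratpoly q.
Proof.
by exists \n_(repr f), \d_(repr f); split; [exact: denom_ratioP|exact: ratfun_numden].
Qed.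

Section Derivation.
Variable i : 'I_N.
Local Notation D := (@ratderiv F N i).

Lemma ratderiv_frac p q : q != 0 ->
  D (ratpoly p / ratpoly q) =
    ratpoly (p^`M(i) * q - p * q^`M(i)) / ratpoly (q ^+ 2).
Proof.
move=> q0; rewrite /ratderiv.
set f := ratpoly p / _; have := ratfun_numden f; have := denom_ratioP (repr f).
(* The canonical representative is generalized to any fraction p' / q' equal to p / q;
   differentiating the cross-multiplied equality gives E'. *)
move: (\n_(repr f)) (\d_(repr f)) => p' q' q'0; rewrite {}/f.
move/(ratpoly_fracP _ _ q0 q'0) => E.
apply/ratpoly_fracP; rewrite ?expf_neq0 //.
have E' : p^`M(i) * q' + p * q'^`M(i) = p'^`M(i) * q + p' * q^`M(i).
  by rewrite -!mderivM E.
exact: quotient_rule_wd E E'.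
Qed.

Lemma ratderivD f g : D (f + g) = D f + D g.
Proof.
have [p [q [q0 ->]]] := ratfun_frac f; have [p' [q' [q'0 ->]]] := ratfun_frac g.
have nz (r : {mpoly F[N]}) : r != 0 -> ratpoly r != 0 by rewrite ratpoly_eq0.
rewrite (rmorph_addf _ _ (nz _ q0) (nz _ q'0)) !ratderiv_frac ?mulf_neq0 //.
have q20 := expf_neq0 2 q0; have q'20 := expf_neq0 2 q'0.
rewrite (rmorph_addf _ _ (nz _ q20) (nz _ q'20)).
apply/ratpoly_fracP; rewrite ?expf_neq0 ?mulf_neq0 //.
by rewrite mderivD !mderivM; ring.
Qed.

Lemma ratderivM f g : D (f * g) = D f * g + f * D g.
Proof.
have [p [q [q0 ->]]] := ratfun_frac f; have [p' [q' [q'0 ->]]] := ratfun_frac g.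
have nz (r : {mpoly F[N]}) : r != 0 -> ratpoly r != 0 by rewrite ratpoly_eq0.
rewrite rmorph_mulf !ratderiv_frac ?mulf_neq0 // !rmorph_mulf.
have q20 := expf_neq0 2 q0; have q'20 := expf_neq0 2 q'0.
rewrite (rmorph_addf _ _ (nz _ (mulf_neq0 q20 q'0)) (nz _ (mulf_neq0 q0 q'20))).
apply/ratpoly_fracP; rewrite ?mulf_neq0 ?expf_neq0 ?mulf_neq0 //.
by rewrite !mderivM; ring.
Qed.

Lemma ratderivX k : D (ratpoly 'X_k) = (i == k)%:R.
Proof.
rewrite -[ratpoly 'X_k]divr1 -(rmorph1 (@ratpoly F N)) ratderiv_frac ?oner_neq0 //.
rewrite -mpolyC1 mderivC mulr0 subr0 mulr1 expr1n rmorph1 divr1.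
rewrite mderivX mnm1E eq_sym; case: eqP => [->|_]; last by rewrite scale0r rmorph0.
rewrite scale1r (_ : (U_(k) - U_(k))%MM = 0%MM) ?mpolyX0 ?rmorph1 //.
by apply/mnmP => j; rewrite mnmBE subnn mnm0E.
Qed.

End Derivation.

Section Evaluation.
Variables (K : fieldType) (c : {rmorphism F -> K}) (v : 'I_N -> K).

(* Unlike [rateval], this relation is compatible with the field operations
   without any side condition on regularity. *)
Definition evals_to f (a : K) : Prop :=
  exists p q, [/\ f = ratpoly p / ratpoly q, mmap c v q != 0
                & a = mmap c v p / mmap c v q].

(** The choice made in [rateval] is harmless: two fractions for f satisfy a cross-multiplied
    polynomial identity, which can be evaluated at v and divided by the two nonzero denominators. *)
Lemma evals_to_rateval f a : evals_to f a -> rateval c v f = a.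
Proof.
move=> [p [q [-> q0 ->]]]; rewrite /rateval.
case: pselect => [ex|[]]; last by exists (p, q).
case: (cid ex) => -[p' q'] /= [E q'0].
have nz r : mmap c v r != 0 -> r != 0 by apply: contraNneq => ->; rewrite raddf0.
move/(ratpoly_fracP _ _ (nz _ q0) (nz _ q'0)): E => E.
by symmetry; apply/(rmorph_eqf (phi := mmap c v)) => //=; rewrite E.
Qed.

Lemma evals_to_poly p : evals_to (ratpoly p) (mmap c v p).
Proof. by exists p, 1; rewrite !rmorph1 !divr1 oner_neq0. Qed.

Lemma evals_to_var k : evals_to (ratpoly 'X_k) (v k).
Proof. by have := evals_to_poly 'X_k; rewrite mmapX mmap1U. Qed.

Lemma evals_toD f g a b : evals_to f a -> evals_to g b -> evals_to (f + g) (a + b).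
Proof.
move=> [p [q [-> q0 ->]]] [p' [q' [-> q'0 ->]]].
have nz r : mmap c v r != 0 -> ratpoly r != 0.
  by rewrite ratpoly_eq0; apply: contraNneq => ->; rewrite raddf0.
exists (p * q' + p' * q), (q * q').
rewrite (rmorph_addf _ _ (nz _ q0) (nz _ q'0)); split=> //.
  by rewrite rmorphM mulf_neq0.
exact: (rmorph_addf (phi := mmap c v)).
Qed.

Lemma evals_toM f g a b : evals_to f a -> evals_to g b -> evals_to (f * g) (a * b).
Proof.
move=> [p [q [-> q0 ->]]] [p' [q' [-> q'0 ->]]].
exists (p * p'), (q * q'); rewrite rmorph_mulf; split=> //.
  by rewrite rmorphM mulf_neq0.
exact: rmorph_mulf.
Qed.

Lemma evals_toN f a : evals_to f a -> evals_to (- f) (- a).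
Proof. by move=> [p [q [-> q0 ->]]]; exists (- p), q; rewrite !rmorphN !mulNr. Qed.

(** The condition on a keeps the old numerator, now the denominator, from vanishing at v. *)
Lemma evals_toV f a : a != 0 -> evals_to f a -> evals_to f^-1 a^-1.
Proof.
move=> a0 [p [q [-> q0 E]]]; exists q, p; rewrite E !invf_div; split=> //.
by apply: contraNneq a0 => p0; rewrite E p0 mul0r.
Qed.

End Evaluation.
End RationalFunctions.

(** * The linear recurrence and its Casoratian *)

(** Arbitrary parameters in an arbitrary ring allow the same identities to be used for the
    polynomials [Rb] and for the rational functions at h = z01, x = z11 / q1, with ring morphisms
    passing between them. *)
Fixpoint rb (K : comNzRingType) (h x q : K) (m : nat) : K :=
  match m with
  | 0 => 1
  | m1.+1 => match m1 with
    | 0 => h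
    | m2.+1 => (h + x) * rb h x q m1 - (h + q) * x * rb h x q m2
    end
  end.

Lemma rbSS (K : comNzRingType) (h x q : K) m :
  rb h x q m.+2 = (h + x) * rb h x q m.+1 - (h + q) * x * rb h x q m.
Proof. by []. Qed.

Section Recurrence.
Variables (K : comNzRingType) (h x q : K).
Local Notation rb := (@rb _ h x q).

Definition rsigma (m : nat) : K := \sum_(0 <= j < m.+1) x ^+ (m - j) * rb j.

Definition casorati (j : nat) : K := q * x * ((h + q) * x) ^+ j.

Lemma casoratiS j : casorati j.+1 = (h + q) * x * casorati j.
Proof. by rewrite /casorati exprS mulrCA. Qed.

(** Up to sign this is a 2 x 2 determinant of consecutive terms; a step of the recurrence multiplies
    it by the coefficient (h + q) x, and its initial value is q x. *)
Lemma rb_casorati j : rb j.+1 ^+ 2 - rb j * rb j.+2 = casorati j.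
Proof.
elim: j => [|j IH]; first by rewrite /casorati /= expr0; ring.
by rewrite casoratiS -IH !rbSS; ring.
Qed.

Lemma casorati_rbD j : rb j * rb j.+2 + casorati j = rb j.+1 ^+ 2.
Proof. by rewrite -rb_casorati addrC subrK. Qed.

Lemma rsigmaS m : rsigma m.+1 = x * rsigma m + rb m.+1.
Proof.
rewrite /rsigma big_nat_recr //= subnn expr0 mul1r; congr (_ + _).
rewrite big_distrr /=; apply: eq_big_nat => j /andP[_ hj].
by rewrite mulrA -exprS subSn.
Qed.

Lemma rb_rsigma m : (h + q) * x * rb m = q * rsigma m.+1 + (x - q) * rb m.+1.
Proof.
elim: m => [|m IH].
  by rewrite rsigmaS /rsigma big_nat1 /= expr0; ring.
have -> : q * rsigma m.+2 = x * (q * rsigma m.+1) + q * rb m.+2.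
  by rewrite rsigmaS; ring.
have -> : q * rsigma m.+1 = (h + q) * x * rb m - (x - q) * rb m.+1.
  by rewrite IH addrK.
by rewrite rbSS; ring.
Qed.

End Recurrence.

Lemma rb_scale (K : comNzRingType) (c h x q : K) m :
  rb (c * h) (c * x) (c * q) m = c ^+ m * rb h x q m.
Proof.
elim/ltn_ind: m => -[|[|m]] IH; [by rewrite /= mul1r | by [] |].
by rewrite !rbSS !IH ?ltnS ?leqnSn // !exprS; ring.
Qed.

Lemma rb_x0 (K : comNzRingType) (h q : K) m : rb h 0 q m = h ^+ m.
Proof.
case: m => // m; elim: m => // m IH.
by rewrite rbSS IH mulr0 mul0r subr0 addr0 -exprS.
Qed.

Lemma rmorph_rb (K L : comNzRingType) (phi : {rmorphism K -> L}) h x q m :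
  phi (rb h x q m) = rb (phi h) (phi x) (phi q) m.
Proof.
elim/ltn_ind: m => -[|[|m]] IH; [exact: rmorph1 | by [] |].
by rewrite !rbSS rmorphB !rmorphM !rmorphD !IH ?ltnS ?leqnSn.
Qed.

Lemma rmorph_rsigma (K L : comNzRingType) (phi : {rmorphism K -> L}) h x q m :
  phi (rsigma h x q m) = rsigma (phi h) (phi x) (phi q) m.
Proof.
rewrite rmorph_sum; apply: eq_bigr => j _.
by rewrite rmorphM rmorphXn rmorph_rb.
Qed.

Section FieldRecurrence.
Variables (K : fieldType) (h x q : K).
Local Notation rb := (@rb _ h x q).
Local Notation rs := (rsigma h x q).
Local Notation D := (casorati h x q).
Hypotheses (x0 : x != 0) (q0 : q != 0) (hq0 : h + q != 0).
Hypothesis rb0 : forall j, rb j != 0.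

Lemma casorati_neq0 j : D j != 0.
Proof. by rewrite !mulf_neq0 ?expf_neq0 ?mulf_neq0. Qed.

(** The Casoratian identity divided by rb_j; in the closed form it is the recursion for
    z_(0,j+2). *)
Lemma rb_rec0 j : rb j.+1 ^+ 2 / rb j - D j / rb j = rb j.+2.
Proof. by rewrite -mulrBl -rb_casorati subKr mulrC mulKf. Qed.

(** The special recursion for z_(1,2), where z11 = q x. *)
Lemma rb_rec1_base : (q^-1 + h^-1) * (q * x) ^+ 2 = D 1 / rb 1.
Proof. by have h0 : h != 0 := rb0 1; rewrite /casorati expr1 /=; field; rewrite h0. Qed.

(** The recursion for z_(1,j+3). The sum of inverses has numerator rb_j rb_(j+2) + D_j = rb_(j+1)^2,
    which cancels the square in the denominator of z_(1,j+2)^2; the rest follows since D is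
    geometric. *)
Lemma rb_rec1 j :
  ((D j / rb j)^-1 + (rb j.+2)^-1) * (D j.+1 / rb j.+1) ^+ 2 = D j.+2 / rb j.+2.
Proof.
have Dj := casorati_neq0 j; have r0 := rb0 j; have r1 := rb0 j.+1; have r2 := rb0 j.+2.
have -> : (D j / rb j)^-1 + (rb j.+2)^-1 = (rb j * rb j.+2 + D j) / (D j * rb j.+2).
  by field; rewrite r0 r2 Dj.
rewrite casorati_rbD !casoratiS.
by field; rewrite r1 r2 Dj.
Qed.

(** For j = n - 4, z is z_(1,n-2) and the first factor is [ftor_cofactor]. By the Casoratian
    identity the factors are rb_(j+1) rb_(j+2) / D_j and D_(j+1) / rb_(j+1), so the product is (h +
    q) x rb_(j+2). *)
Lemma rb_final_factor j : let z := rb j.+2 ^+ 2 / rb j.+1 in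
  (z / (D j / rb j) + z / rb j.+2) * (z - rb j.+3)
    = q * rs j.+3 + (x - q) * rb j.+3.
Proof.
move=> z; rewrite -rb_rsigma.
have Dj := casorati_neq0 j; have r0 := rb0 j; have r1 := rb0 j.+1; have r2 := rb0 j.+2.
have -> : z - rb j.+3 = D j.+1 / rb j.+1 by rewrite -rb_rec0 subKr.
have -> : z / (D j / rb j) + z / rb j.+2
        = (rb j * rb j.+2 + D j) * rb j.+2 / (D j * rb j.+1).
  by rewrite /z; field; rewrite r0 r1 r2 Dj.
rewrite casorati_rbD casoratiS.
by field; rewrite r1 Dj.
Qed.

End FieldRecurrence.

(** * Closed form of the elimination *)

Section Elimination.
Variable F : fieldType.
Local Notation K := (ratfun F 4).
Local Notation h := (z01 F).
Local Notation x := (z11 F / q1 F).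
Local Notation rbK := (rb h x (q1 F)).
Local Notation D := (casorati h x (q1 F)).

Lemma var4_neq0 k : ratpoly (var4 F k) != 0.
Proof. exact: ratpolyX_neq0. Qed.

Lemma var4_coord k l : (k < 4)%N -> (l < 4)%N ->
  (inord k == inord l :> 'I_4) = (k == l).
Proof. by move=> hk hl; rewrite -(inj_eq val_inj) /= !inordK. Qed.

Lemma x_neq0 : x != 0.
Proof. by rewrite mulf_neq0 ?invr_neq0 ?var4_neq0. Qed.

Lemma ratpoly_neq0_meval (v : 'I_4 -> F) (p : {mpoly F[4]}) :
  p.@[v] != 0 -> ratpoly p != 0.
Proof. by rewrite ratpoly_eq0; apply: contraNneq => ->; rewrite meval0. Qed.

Lemma hq_neq0 : h + q1 F != 0.
Proof.
rewrite -rmorphD; apply: (@ratpoly_neq0_meval (fun i => (i == inord 0)%:R)).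
by rewrite mevalD !mevalXU !var4_coord //= addr0 oner_neq0.
Qed.

(* Clearing denominators by homogeneity, it suffices that the polynomial
   [rb (q1 z01) z11 (q1 ^ 2) j] takes the value 1 at z01 = q1 = 1, z11 = 0. *)
Lemma rb_neq0 j : rbK j != 0.
Proof.
have q0 : q1 F != 0 by exact: var4_neq0.
suff : q1 F ^+ j * rbK j != 0 by rewrite mulf_eq0 negb_or => /andP[].
pose u := var4 F 0; pose v := var4 F 1; pose w := var4 F 2.
have -> : q1 F ^+ j * rbK j = ratpoly (rb (w * u) v (w * w) j).
  rewrite -rb_scale rmorph_rb; congr (rb _ _ _ _); last by rewrite /= rmorphM.
    by rewrite /= rmorphM.
  by rewrite mulrC divfK.
apply: (@ratpoly_neq0_meval (fun i => (i != inord 1)%:R)).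
rewrite (rmorph_rb (meval _)) /= !mevalM !mevalXU !var4_coord //= mulr1.
by rewrite rb_x0 expr1n oner_neq0.
Qed.

(** The recursions are coupled, so both closed forms are proved together; z_(0,j+2) comes first
    because z_(1,j+3) depends on it. *)
Lemma zrec_rb j : zrec0 F j = rbK j /\ zrec1 F j.+1 = D j / rbK j.
Proof.
have q0 : q1 F != 0 by exact: var4_neq0.
have E1 : q1 F * x = z11 F by rewrite mulrC divfK.
elim/ltn_ind: j => -[|[|j]] IH.
- by split=> //=; rewrite /casorati expr0 mulr1 divr1 E1.
- split=> //=; rewrite -[z11 F in LHS]E1.
  exact: rb_rec1_base q0 rb_neq0.
have [e0 _] := IH j (ltnW (ltnSn _)); have [e0' e1'] := IH j.+1 (ltnSn _).
have e1 := (IH j (ltnW (ltnSn _))).2.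
have e2 : zrec0 F j.+2 = rbK j.+2.
  by rewrite -(rb_rec0 rb_neq0) -e1 -e0' -e0.
split=> //; rewrite -(rb_rec1 x_neq0 q0 hq_neq0 rb_neq0) -e1 -e1' -e2 //.
Qed.

Lemma zrec0E j : zrec0 F j = rbK j. Proof. by case: (zrec_rb j). Qed.
Lemma zrec1E j : zrec1 F j.+1 = D j / rbK j. Proof. by case: (zrec_rb j). Qed.

Lemma zelim_neq0 n k j : (1 <= j <= n - 2)%N -> zelim F n k j != 0.
Proof.
case: j => // j _; rewrite /zelim; case: ifP => _; first by rewrite zrec0E rb_neq0.
case: ifP => _; first by rewrite !zrec0E mulf_neq0 ?invr_neq0 ?expf_neq0 ?rb_neq0.
rewrite zrec1E mulf_neq0 ?invr_neq0 ?rb_neq0 //.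
exact: casorati_neq0 x_neq0 (var4_neq0 2) hq_neq0 _.
Qed.

End Elimination.

(** * Partial derivatives of f_tor and their values after elimination *)

Section FtorDerivatives.
Variables (F : fieldType) (m : nat).
Local Notation n := m.+4.
Local Notation z := (ftor_z F n).
Local Notation q1 := (ftor_q1 F n).
Local Notation q2 := (ftor_q2 F n).
Local Notation "'D_' j" := (ratderiv (zidx n 1 j)) (at level 10, j at next level).

Let zrange i j := (i <= 1)%N && (1 <= j <= m.+2)%N.

Lemma zidx_val i j : zrange i j -> zidx n i j = (2 + i * m.+2 + j.-1)%N :> nat.
Proof.
rewrite /zrange => h; rewrite /zidx inordK /ftor_nvars ?subSS ?subn0 //.
by move: h; case: i => [|[|]] //; lia.
Qed.

Lemma zidx_inj i j i' j' : zrange i j -> zrange i' j' ->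
  (zidx n i j == zidx n i' j') = (i == i') && (j == j').
Proof.
move=> h h'; rewrite -(inj_eq val_inj) /= !zidx_val //.
by move: h h'; rewrite /zrange; case: i i' => [|[|]] // [|[|]] //; lia.
Qed.

Lemma zidx_neq_q k i j : zrange i j -> (k < 2)%N -> (zidx n i j == inord k) = false.
Proof.
move=> h hk; rewrite -(inj_eq val_inj) /= zidx_val // inordK /ftor_nvars; last by lia.
by apply/eqP; lia.
Qed.

Lemma ratderiv_z j i j' : zrange 1 j -> zrange i j' ->
  D_ j (z i j') = ((1 == i)%N && (j == j'))%:R.
Proof. by move=> h h'; rewrite ratderivX zidx_inj. Qed.

Lemma ratderiv_q1 j : zrange 1 j -> D_ j q1 = 0.
Proof. by move=> h; rewrite ratderivX zidx_neq_q. Qed.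

Lemma ratderiv_q2 j : zrange 1 j -> D_ j q2 = 0.
Proof. by move=> h; rewrite ratderivX zidx_neq_q. Qed.

(** The convention z_(1,0) = q1, under which z_(1,1) / q1 becomes the term k = 1 of the sum of the
    z_(1,k) / z_(1,k-1). *)
Local Notation zz k := (if k == 0%N then q1 else z 1 k).

Lemma ratderiv_div0 j (a b : ratfun F (ftor_nvars n)) :
  D_ j a = 0 -> D_ j b = 0 -> D_ j (a / b) = 0.
Proof.
exact: (derivation_div0 (@ratderivD _ _ (zidx n 1 j)) (@ratderivM _ _ (zidx n 1 j))).
Qed.

Lemma ratderiv_div j (a b : ratfun F (ftor_nvars n)) :
  D_ j (a / b) = D_ j a / b - a * D_ j b / b ^+ 2.
Proof.
exact: (derivation_div (@ratderivD _ _ (zidx n 1 j)) (@ratderivM _ _ (zidx n 1 j))).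
Qed.

Lemma ratderiv_sum j lo hi (f : nat -> ratfun F (ftor_nvars n)) :
  D_ j (\sum_(lo <= k < hi) f k) = \sum_(lo <= k < hi) D_ j (f k).
Proof. exact: (derivation_sum (@ratderivD _ _ (zidx n 1 j))). Qed.

Lemma ratderiv_q1q2 j : zrange 1 j -> D_ j (q1 * q2) = 0.
Proof.
by move=> h; rewrite ratderivM ratderiv_q1 // ratderiv_q2 // mul0r mulr0 addr0.
Qed.

(** The variable z_(1,j) occurs as a numerator for k = j and as a denominator for k = j + 1; the
    second term lies in the range only if j < n - 2. *)
Lemma ratderiv_z1_sum j : zrange 1 j ->
  D_ j (z 1 1 / q1) + \sum_(2 <= k < m.+3) D_ j (z 1 k / z 1 k.-1)
  = (zz j.-1)^-1 - (if (j < m.+2)%N then z 1 j.+1 / z 1 j ^+ 2 else 0).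
Proof.
move=> h; have j0 : (0 < j)%N by case/and3P: h.
have -> : D_ j (z 1 1 / q1) + \sum_(2 <= k < m.+3) D_ j (z 1 k / z 1 k.-1)
    = \sum_(1 <= k < m.+3) D_ j (z 1 k / zz k.-1).
  by rewrite [RHS]big_ltn //=; congr (_ + _); apply: eq_big_nat; case=> [|[|k]].
have -> : \sum_(1 <= k < m.+3) D_ j (z 1 k / zz k.-1)
    = \sum_(1 <= k < m.+3) ((if k == j then (zz k.-1)^-1 else 0)
                            - (if k == j.+1 then z 1 k / z 1 j ^+ 2 else 0)).
  apply: eq_big_nat => k hk; rewrite ratderiv_div (ratderiv_z h) // eqxx [j == k]eq_sym.
  congr (_ - _); first by case: (k == j); rewrite ?mul1r ?mul0r.
  case: k hk => [//|[|k]] hk; rewrite ?eqSS /=.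
    by rewrite (ltn_eqF j0) ratderiv_q1 // mulr0 mul0r.
  rewrite ratderiv_z // /zrange; last by lia.
  rewrite eqxx eq_sym /=; case: eqP => [<-|_]; first by rewrite mulr1.
  by rewrite mulr0 mul0r.
rewrite sumrB -!big_mkcond !big_nat1_eq /=.
by case/andP: h => _; rewrite !ltnS => ->.
Qed.

(** For j = n - 2 the last term of f_tor supplies the missing quotient, with q1 q2 in the place of
    z_(1,n-1). *)
Lemma ratderiv_ftor j : zrange 1 j -> D_ j (ftor F n) =
  (zz j.-1)^-1 + (z 0 j)^-1
    - (if (j < m.+2)%N then z 1 j.+1 else q1 * q2) / z 1 j ^+ 2.
Proof.
move=> h; have Dz0 k : (1 <= k <= m.+2)%N -> D_ j (z 0 k) = 0.
  by move=> hk; rewrite ratderiv_z.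
rewrite /ftor !subSS !subn0 !ratderivD !ratderiv_sum Dz0 // add0r.
rewrite big_nat_cond big1 ?add0r; last first.
  by move=> k /andP[hk _]; apply: ratderiv_div0; apply: Dz0; lia.
rewrite ratderiv_z1_sum // ratderiv_div ratderiv_q1q2 // mul0r sub0r.
rewrite [D_ _ (z 1 m.+2)](ratderiv_z h) /zrange ?leqnn //=.
rewrite (_ : \sum_(1 <= k < m.+3) D_ j (z 1 k / z 0 k)
    = \sum_(1 <= k < m.+3) (if k == j then (z 0 k)^-1 else 0)); last first.
  apply: eq_big_nat => k hk; rewrite ratderiv_div ratderiv_z // Dz0 //.
  rewrite mulr0 mul0r subr0 eqxx eq_sym.
  by case: (k == j); rewrite ?mul1r ?mul0r.
rewrite -big_mkcond big_nat1_eq ltnS.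
case/andP: (h) => _ hj.
have aux (V : zmodType) (a b c d : V) : a - b + c - d = a + c - (b + d).
  by rewrite -!addrA; congr (_ + _); rewrite addrCA opprD.
rewrite hj aux; congr (_ - _).
have [hlt|hge] := leqP j m.+1.
  by rewrite (_ : j == m.+2 = false) ?mulr0 ?mul0r ?addr0 //; lia.
by rewrite (_ : j = m.+2) ?eqxx ?mulr1 ?add0r //; lia.
Qed.

Lemma elim_point_zidx i j : zrange i j -> elim_point F (zidx n i j) = zelim F n i j.
Proof.
move=> h; rewrite /elim_point zidx_val // -addnA /= add2n !subSS !subn0.
have hj : (j.-1 < m.+2)%N by move: h; rewrite /zrange; lia.
rewrite divnMDl // modnMDl divn_small // modn_small // addn0 prednK //.
by case/and3P: h.
Qed.

Lemma elim_point_q k : (k < 2)%N -> elim_point F (inord k : 'I_(ftor_nvars n)) =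
  if k == 0%N then Defs.q1 F else Defs.q2 F.
Proof.
by move=> hk; rewrite /elim_point inordK /ftor_nvars; [case: k hk => [|[|]] | lia].
Qed.

Local Notation ev := (evals_to (@ratconst F 4) (@elim_point F n)).

Lemma evals_to_z i j : zrange i j -> ev (z i j) (zelim F n i j).
Proof. by move=> h; rewrite -elim_point_zidx //; exact: evals_to_var. Qed.

Lemma evals_to_q1 : ev q1 (Defs.q1 F).
Proof.
have := evals_to_var (@ratconst F 4) (@elim_point F n) (inord 0).
by rewrite elim_point_q.
Qed.

Lemma evals_to_q2 : ev q2 (Defs.q2 F).
Proof.
have := evals_to_var (@ratconst F 4) (@elim_point F n) (inord 1).
by rewrite elim_point_q.
Qed.

Local Notation zelim1 k := (if k == 0%N then Defs.q1 F else zelim F n 1 k).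

(** The only elements inverted here are variables and a square of one; their values are nonzero, so
    the substitution goes through term by term. *)
Lemma ftor_exprE j : zrange 1 j -> ftor_expr F n j =
  zelim F n 1 j ^+ 2 * ((zelim1 j.-1)^-1 + (zelim F n 0 j)^-1
    - (if (j < m.+2)%N then zelim F n 1 j.+1 else Defs.q1 F * Defs.q2 F)
        / zelim F n 1 j ^+ 2).
Proof.
move=> h; rewrite /ftor_expr ratderiv_ftor //; apply: evals_to_rateval.
have h1 k : (0 < k <= m.+2)%N -> ev (z 1 k) (zelim F n 1 k).
  by move=> hk; apply: evals_to_z.
have h2 : ev (z 1 j ^+ 2) (zelim F n 1 j ^+ 2).
  by rewrite !expr2; apply: evals_toM; apply: evals_to_z.
have z0 i : zelim F n i j != 0 by apply: zelim_neq0; case/andP: h.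
apply: evals_toM => //; apply: evals_toD; last first.
  apply: evals_toN; apply: evals_toM; last by apply: evals_toV; rewrite ?expf_neq0.
  case: ifP => hj; first by apply: h1.
  by apply: evals_toM; [exact: evals_to_q1 | exact: evals_to_q2].
apply: evals_toD; last by apply: evals_toV => //; apply: evals_to_z; case/andP: h.
case: eqP => hj; first by apply: evals_toV; [exact: var4_neq0 | exact: evals_to_q1].
apply: evals_toV; last by apply: h1; move: h hj; rewrite /zrange; lia.
by apply: zelim_neq0; move: h hj; rewrite /zrange; lia.
Qed.

End FtorDerivatives.

(** * The two expressions of the theorem *)

Lemma mul_sub_div (K : fieldType) (a b c : K) : a != 0 -> a * (b - c / a) = a * b - c.
Proof. by move=> a0; rewrite mulrBr mulrCA divff // mulr1. Qed.

Section FtorExpressions.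
Variables (F : fieldType) (m : nat).
Local Notation n := m.+4.
Local Notation h := (z01 F).
Local Notation x := (z11 F / q1 F).
Local Notation rbK := (rb h x (q1 F)).
Local Notation rsK := (rsigma h x (q1 F)).

Lemma zelim_last : zelim F n 1 m.+2 = rbK m.+2 ^+ 2 / rbK m.+1.
Proof. by rewrite /zelim !subSS !subn0 eqxx !zrec0E. Qed.

Lemma zelim_nonlast k : (k < m.+2)%N -> zelim F n 1 k = zrec1 F k.
Proof. by move=> hk; rewrite /zelim !subSS !subn0 (ltn_eqF hk). Qed.

Lemma zelim1_sq_neq0 k : (0 < k <= m.+2)%N -> zelim F n 1 k ^+ 2 != 0.
Proof. by move=> hk; rewrite expf_neq0 // zelim_neq0 // !subSS subn0. Qed.

Lemma ftor_expr_penult : ftor_expr F n m.+1 = - rbK m.+3.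
Proof.
rewrite ftor_exprE ?leqnSn // [m.+1.-1]/= ltnSn mul_sub_div; last first.
  by rewrite zelim1_sq_neq0 ?leqnSn.
(* With z_(1,n-2) cancelled, what remains is the recursion formula for [zrec1] at n - 2, a value
   that [zelim] replaces by the prescribed one. *)
rewrite zelim_last -(rb_rec0 (rb_neq0 F) m.+1) opprB -zrec1E; congr (_ - _).
rewrite zelim_nonlast // mulrC.
(* For n = 4 this is the special formula for z_(1,2), with q1 in the place of z_(1,0). *)
have [->|m0] := eqVneq m 0%N; first by [].
rewrite zelim_nonlast; last by rewrite leqW.
by case: m m0.
Qed.

Lemma ftor_expr_last : ftor_expr F n m.+2 =
  q1 F * rsK m.+3 + (x - q1 F) * rbK m.+3 - q1 F * q2 F
    - ftor_cofactor F n * ftor_expr F n m.+1.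
Proof.
have q0 : q1 F != 0 by exact: var4_neq0.
rewrite ftor_expr_penult ftor_exprE ?leqnn // [m.+2.-1]/= ltnn mul_sub_div; last first.
  by rewrite zelim1_sq_neq0 /=.
rewrite -(rb_final_factor (x_neq0 F) q0 (hq_neq0 F) (rb_neq0 F)) -zelim_last.
rewrite -zrec1E -zelim_nonlast // -(zrec0E F m.+2) /ftor_cofactor !subSS !subn0.
rewrite -[zrec0 F m.+2]/(zelim F n 0 m.+2).
(* Here c is z_(1,n-2), d and e are the inverses of z_(1,n-3) and z_(0,n-2), a = q1 q2 and b =
   rb_(n-1); thus c d + c e is the cofactor and - b the first expression. *)
have aux (K : comNzRingType) (a b c d e : K) :
    c ^+ 2 * (d + e) - a = (c * d + c * e) * (c - b) - a - (c * d + c * e) * - b.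
  by ring.
exact: aux.
Qed.

End FtorExpressions.

(** * Morphisms between quotients by two elements *)

Lemma quot2_pi1 (C : comNzRingType) (c1 c2 : C) : quot2_pi c1 c2 1 = 1.
Proof. by []. Qed.

Lemma quot2_piB (C : comNzRingType) (c1 c2 x y : C) :
  quot2_pi c1 c2 (x - y) = quot2_pi c1 c2 x - quot2_pi c1 c2 y.
Proof. exact: (raddfB (\pi_(Quotient.quot (ideal2 c1 c2)))%qT). Qed.

Section Quotient2Map.
Variables (A B : comNzRingType) (a1 a2 : A) (b1 b2 : B).

Lemma ideal2_map (phi : {rmorphism A -> B}) x :
  phi a1 \in ideal2 b1 b2 -> phi a2 \in ideal2 b1 b2 ->
  x \in ideal2 a1 a2 -> phi x \in ideal2 b1 b2.
Proof.
move=> h1 h2 /asboolP[c [d ->]].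
by rewrite rmorphD !rmorphM rpredD ?ideal2Ml.
Qed.

Definition quot2_map (phi : A -> B) (x : quot2 a1 a2) : quot2 b1 b2 :=
  quot2_pi b1 b2 (phi (quot2_repr x)).

Variable phi : {rmorphism A -> B}.
Hypotheses (phi1 : phi a1 \in ideal2 b1 b2) (phi2 : phi a2 \in ideal2 b1 b2).

Lemma quot2_map_pi x : quot2_map phi (quot2_pi a1 a2 x) = quot2_pi b1 b2 (phi x).
Proof.
apply/quot2_eqP; rewrite -rmorphB; apply: ideal2_map => //.
by apply/quot2_eqP; rewrite quot2_reprK.
Qed.

Lemma quot2_map_is_zmod_morphism : zmod_morphism (quot2_map phi).
Proof.
move=> x y; rewrite -(quot2_reprK x) -(quot2_reprK y) -quot2_piB !quot2_map_pi.
by rewrite rmorphB quot2_piB.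
Qed.

Lemma quot2_map_is_monoid_morphism : monoid_morphism (quot2_map phi).
Proof.
split=> [|x y]; first by rewrite -quot2_pi1 quot2_map_pi rmorph1.
rewrite -(quot2_reprK x) -(quot2_reprK y) -[_ * _]quot2_piM !quot2_map_pi.
by rewrite rmorphM quot2_piM.
Qed.

End Quotient2Map.

Lemma quot2_iso (A B : comNzRingType) (a1 a2 : A) (b1 b2 : B)
    (phi : {rmorphism A -> B}) (psi : {rmorphism B -> A}) :
  cancel phi psi -> cancel psi phi ->
  phi a1 \in ideal2 b1 b2 -> phi a2 \in ideal2 b1 b2 ->
  psi b1 \in ideal2 a1 a2 -> psi b2 \in ideal2 a1 a2 ->
  exists f : {rmorphism quot2 a1 a2 -> quot2 b1 b2},
    bijective f /\ forall x, f (quot2_pi a1 a2 x) = quot2_pi b1 b2 (phi x).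
Proof.
move=> phiK psiK h1 h2 k1 k2.
(* Compatibility with the ring operations depends on h1 and h2, so the morphism structure is packed
   locally. *)
pose fA := GRing.isZmodMorphism.Build _ _ _ (quot2_map_is_zmod_morphism h1 h2).
pose fM := GRing.isMonoidMorphism.Build _ _ _ (quot2_map_is_monoid_morphism h1 h2).
pose f : {rmorphism quot2 a1 a2 -> quot2 b1 b2} :=
  HB.pack (@quot2_map _ _ a1 a2 b1 b2 phi) fA fM.
have fE y : f (quot2_pi a1 a2 y) = quot2_pi b1 b2 (phi y) by exact: quot2_map_pi.
have gE y : quot2_map a1 a2 psi (quot2_pi b1 b2 y) = quot2_pi a1 a2 (psi y).
  exact: quot2_map_pi.
exists f; split=> //; exists (quot2_map a1 a2 psi) => x.
  by rewrite -(quot2_reprK x) fE gE phiK.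
by rewrite -(quot2_reprK x) gE fE psiK.
Qed.

(** * Morphisms of Laurent polynomial rings *)

Lemma mulr_inv_uniq (B : comNzRingType) (a b c : B) : a * b = 1 -> a * c = 1 -> b = c.
Proof. by move=> ab ac; rewrite -[b]mulr1 -ac mulrCA mulrA ab mul1r. Qed.

Section LaurentInstances.
Variables (F : fieldType) (N : nat).

Lemma lpoly_is_zmod_morphism : zmod_morphism (@lpoly F N).
Proof. by move=> p q; apply: val_inj; rewrite /= rmorphB. Qed.

Lemma lpoly_is_monoid_morphism : monoid_morphism (@lpoly F N).
Proof.
by split=> [|p q]; apply: val_inj; rewrite /= ?rmorphM ?rmorph1.
Qed.

HB.instance Definition _ :=
  GRing.isZmodMorphism.Build _ _ (@lpoly F N) lpoly_is_zmod_morphism.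
HB.instance Definition _ :=
  GRing.isMonoidMorphism.Build _ _ (@lpoly F N) lpoly_is_monoid_morphism.

Lemma laurent_val_is_zmod_morphism : zmod_morphism (@laurent_val F N).
Proof. by []. Qed.

Lemma laurent_val_is_monoid_morphism : monoid_morphism (@laurent_val F N).
Proof. by []. Qed.

HB.instance Definition _ := GRing.isZmodMorphism.Build _ _ (@laurent_val F N)
  laurent_val_is_zmod_morphism.
HB.instance Definition _ := GRing.isMonoidMorphism.Build _ _ (@laurent_val F N)
  laurent_val_is_monoid_morphism.

End LaurentInstances.

Section LaurentMorphisms.
Variables (F : fieldType) (N : nat).
Local Notation L := (laurent F N).

Lemma monomialV_laurent m : (ratpoly 'X_[F, m])^-1 \in @is_laurent F N.
Proof. by apply/asboolP; exists 1, m; rewrite rmorph1 div1r. Qed.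

Definition lmonV m : L := Laurent (monomialV_laurent m).

Lemma lmonVK m : lpoly 'X_[m] * lmonV m = 1.
Proof. by apply: val_inj; rewrite /= divff // ratpolyX_neq0. Qed.

Lemma laurentE (f : L) : exists p m, f = lpoly p * lmonV m.
Proof.
case: f => f hf; case/asboolP: (hf) => p [m E]; exists p, m.
by apply: val_inj; rewrite /= E.
Qed.

Lemma mpoly_rmorph_ext (B : comNzRingType) (f g : {rmorphism {mpoly F[N]} -> B}) :
  (forall c, f c%:MP = g c%:MP) -> (forall k, f 'X_k = g 'X_k) -> f =1 g.
Proof.
move=> hc hX p; rewrite [p]mpolyE !rmorph_sum; apply: eq_bigr => m _.
rewrite -mul_mpolyC !rmorphM hc; congr (_ * _); rewrite mpolyXE_id !rmorph_prod.
by apply: eq_bigr => k _; rewrite !rmorphXn hX.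
Qed.

(** A morphism sends the inverse of a monomial to the inverse of its image, and inverses are unique;
    so agreement on polynomials suffices. *)
Lemma laurent_rmorph_ext (B : comNzRingType) (f g : {rmorphism L -> B}) :
  (forall c, f (lpoly c%:MP) = g (lpoly c%:MP)) ->
  (forall k, f (lpoly 'X_k) = g (lpoly 'X_k)) -> f =1 g.
Proof.
move=> hc hX u; have [p [m ->]] := laurentE u.
have E : f \o @lpoly F N =1 g \o @lpoly F N by exact: mpoly_rmorph_ext.
rewrite !rmorphM; congr (_ * _); first exact: E.
apply: (@mulr_inv_uniq _ (f (lpoly 'X_[m]))); first by rewrite -rmorphM lmonVK rmorph1.
by rewrite [f _]E /= -rmorphM lmonVK rmorph1.
Qed.

Section Substitution.
Variables (M : nat) (v v' : 'I_N -> laurent F M).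
Hypothesis vK : forall i, v i * v' i = 1.

Local Notation ev f g := (evals_to (@ratconst F M) (fun i => laurent_val (v i))
  (laurent_val f) (laurent_val g)).

(** Since each v i is a unit with inverse v' i, dividing by a monomial at v amounts to multiplying
    by powers of the v' i, and the value stays a Laurent polynomial. *)
Lemma laurent_evals (f : L) : exists g : laurent F M, ev f g.
Proof.
have [p [m ->]] := laurentE f.
pose lconst := @lpoly F M \o @mpolyC M F.
have E q : laurent_val (mmap lconst v q)
    = mmap (@ratconst F M) (fun i => laurent_val (v i)) q.
  rewrite /mmap rmorph_sum; apply: eq_bigr => k _.
  rewrite rmorphM /= /mmap1 rmorph_prod; congr (_ * _).
  by apply: eq_bigr => i _; rewrite rmorphXn.
exists (mmap lconst v p * \prod_i v' i ^+ m i); rewrite /=.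
apply: evals_toM; first by rewrite E; exact: evals_to_poly.
have K1 : mmap lconst v 'X_[m] * \prod_i v' i ^+ m i = 1.
  rewrite mmapX /mmap1 -big_split big1 //= => i _.
  by rewrite -exprMn vK expr1n.
have K2 := congr1 (@laurent_val F M) K1; rewrite /= E in K2.
have nz : mmap (@ratconst F M) (fun i => laurent_val (v i)) 'X_[m] != 0.
  by apply: contraTneq (oner_neq0 (ratfun F M)) => e; rewrite -K2 e mul0r eqxx.
have -> : laurent_val (\prod_i v' i ^+ m i)
    = (mmap (@ratconst F M) (fun i => laurent_val (v i)) 'X_[m])^-1.
  by apply: (mulfI nz); rewrite K2 divff.
by apply: evals_toV => //; exact: evals_to_poly.
Qed.

(** Choosing the value through [evals_to] avoids any dependence on a presentation p / X^m;
    uniqueness of the value then yields the morphism laws. *)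
Definition lsubst (f : L) : laurent F M := projT1 (cid (laurent_evals f)).

Lemma evals_lsubst f : ev f (lsubst f).
Proof. by rewrite /lsubst; case: cid. Qed.

Lemma lsubst_uniq (f : L) (g : laurent F M) : ev f g -> lsubst f = g.
Proof.
move=> h; apply: val_inj => /=.
by rewrite -(evals_to_rateval (evals_lsubst f)) (evals_to_rateval h).
Qed.

Lemma lsubst_is_zmod_morphism : zmod_morphism lsubst.
Proof.
move=> f g; apply: lsubst_uniq; apply: evals_toD; first exact: evals_lsubst.
by apply: evals_toN; exact: evals_lsubst.
Qed.

Lemma lsubst_is_monoid_morphism : monoid_morphism lsubst.
Proof.
split=> [|f g]; apply: lsubst_uniq; last by apply: evals_toM; exact: evals_lsubst.
have := evals_to_poly (@ratconst F M) (fun i => laurent_val (v i)) 1.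
by rewrite !rmorph1.
Qed.

HB.instance Definition _ :=
  GRing.isZmodMorphism.Build _ _ lsubst lsubst_is_zmod_morphism.
HB.instance Definition _ :=
  GRing.isMonoidMorphism.Build _ _ lsubst lsubst_is_monoid_morphism.

Lemma laurent_val_lsubst p : laurent_val (lsubst (lpoly p))
  = mmap (@ratconst F M) (fun i => laurent_val (v i)) p.
Proof.
have /evals_to_rateval <- := evals_lsubst (lpoly p).
exact: evals_to_rateval (evals_to_poly _ _ p).
Qed.

Lemma lsubstC c : lsubst (lpoly c%:MP) = lpoly c%:MP.
Proof. by apply: val_inj; rewrite /= laurent_val_lsubst mmapC. Qed.

Lemma lsubstX k : lsubst (lpoly 'X_k) = v k.
Proof. by apply: val_inj; rewrite /= laurent_val_lsubst mmapX mmap1U. Qed.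

End Substitution.
End LaurentMorphisms.

(** * The change of variables z11 = q1 x *)

Section Identification.
Variable F : fieldType.
Local Notation L := (laurent F 4).

Lemma Rb_rb m : Rb F m = rb (hh F) (xx F) (qq1 F) m.
Proof. by elim/ltn_ind: m => -[|[|m]] IH //; rewrite rbSS -!IH ?ltnS ?leqnSn. Qed.

Lemma Rsigma_rsigma m : Rsigma F m = rsigma (hh F) (xx F) (qq1 F) m.
Proof. by apply: eq_bigr => j _; rewrite Rb_rb. Qed.

HB.instance Definition _ := GRing.RMorphism.copy (@identify F)
  (mmap (@ratconst F 4) (fun i => [:: z01 F; z11 F / q1 F; q1 F; q2 F]`_i)).

Lemma identify_var k : (k < 4)%N ->
  identify (var4 F k) = [:: z01 F; z11 F / q1 F; q1 F; q2 F]`_k.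
Proof. by move=> hk; rewrite /identify mmapX mmap1U inordK. Qed.

Lemma identify_Rb m : identify (Rb F m) = rb (z01 F) (z11 F / q1 F) (q1 F) m.
Proof. by rewrite Rb_rb (rmorph_rb (@identify F)) /= !identify_var. Qed.

Lemma identify_Rsigma m :
  identify (Rsigma F m) = rsigma (z01 F) (z11 F / q1 F) (q1 F) m.
Proof. by rewrite Rsigma_rsigma (rmorph_rsigma (@identify F)) /= !identify_var. Qed.

Definition lvar (k : nat) : L := lpoly (var4 F k).
Definition lvarV (k : nat) : L := lmonV F U_(inord k).

Lemma lvarK k : lvar k * lvarV k = 1. Proof. exact: lmonVK. Qed.

Lemma ord4P (P : 'I_4 -> Prop) :
  P (inord 0) -> P (inord 1) -> P (inord 2) -> P (inord 3) -> forall i, P i.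
Proof.
move=> P0 P1 P2 P3 i; rewrite -(inord_val i).
by case: i => -[|[|[|[|i]]]].
Qed.

(** Both Laurent rings are [laurent F 4], so z11 |-> q1 x and its inverse x |-> z11 / q1 become
    automorphisms of one ring. The points with suffix V provide the inverses that [lsubst] asks
    for. *)
Definition to_hx_pt (i : 'I_4) : L :=
  [:: lvar 0; lvar 2 * lvar 1; lvar 2; lvar 3]`_i.
Definition to_hx_ptV (i : 'I_4) : L :=
  [:: lvarV 0; lvarV 2 * lvarV 1; lvarV 2; lvarV 3]`_i.

Definition to_z_pt (i : 'I_4) : L :=
  [:: lvar 0; lvar 1 * lvarV 2; lvar 2; lvar 3]`_i.
Definition to_z_ptV (i : 'I_4) : L :=
  [:: lvarV 0; lvarV 1 * lvar 2; lvarV 2; lvarV 3]`_i.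

Lemma to_hx_ptK i : to_hx_pt i * to_hx_ptV i = 1.
Proof.
elim/ord4P: i; rewrite /to_hx_pt /to_hx_ptV !inordK //= ?lvarK //.
by rewrite mulrACA !lvarK mulr1.
Qed.

Lemma to_z_ptK i : to_z_pt i * to_z_ptV i = 1.
Proof.
elim/ord4P: i; rewrite /to_z_pt /to_z_ptV !inordK //= ?lvarK //.
by rewrite mulrACA [lvarV 2 * _]mulrC !lvarK mulr1.
Qed.

Definition to_hx : {rmorphism L -> L} := lsubst to_hx_ptK.
Definition to_z : {rmorphism L -> L} := lsubst to_z_ptK.

Lemma to_hx_var k : (k < 4)%N ->
  to_hx (lvar k) = [:: lvar 0; lvar 2 * lvar 1; lvar 2; lvar 3]`_k.
Proof. by move=> hk; rewrite /to_hx /= lsubstX /to_hx_pt inordK. Qed.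

Lemma to_z_var k : (k < 4)%N ->
  to_z (lvar k) = [:: lvar 0; lvar 1 * lvarV 2; lvar 2; lvar 3]`_k.
Proof. by move=> hk; rewrite /to_z /= lsubstX /to_z_pt inordK. Qed.

Lemma to_hxK : cancel to_hx to_z.
Proof.
apply: (laurent_rmorph_ext (f := to_z \o to_hx) (g := idfun)) => [c|k] /=.
  by rewrite !lsubstC.
elim/ord4P: k; rewrite -/(lvar _) to_hx_var //= ?rmorphM /= !to_z_var //=.
by rewrite mulrCA lvarK mulr1.
Qed.

Lemma to_zK : cancel to_z to_hx.
Proof.
apply: (laurent_rmorph_ext (f := to_hx \o to_z) (g := idfun)) => [c|k] /=.
  by rewrite !lsubstC.
elim/ord4P: k; rewrite -/(lvar _) to_z_var //= ?rmorphM /= ?to_hx_var //=.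
(* Instead of computing the image of q1^-1, the factor q1 is rewritten as its own image, so that the
   two combine into the image of 1. *)
rewrite mulrAC -[lvar 2 in X in X * _](to_hx_var (k := 2)) //= -rmorphM.
by rewrite lvarK rmorph1 mul1r.
Qed.

(** This realizes identified polynomials inside the Laurent ring, where the generators of the Jacobi
    ideal have to lie. *)
Lemma laurent_val_to_z p : laurent_val (to_z (lpoly p)) = identify p.
Proof.
rewrite /to_z /= laurent_val_lsubst; congr (mmap _ _ p).
by apply: funext; elim/ord4P; rewrite /to_z_pt !inordK.
Qed.

End Identification.

(** * The expressions and the isomorphism assembled *)

Lemma ideal2P (A : comNzRingType) (g1 g2 a b y : A) :
  y = a * g1 + b * g2 -> y \in ideal2 g1 g2.
Proof. by move=> ->; apply/asboolP; exists a, b. Qed.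

Theorem theorem6p3 (R : realType) (n : nat) (hn : (4 <= n)%N) :
  [/\ (* all the eliminated functions are nonzero, so no division by 0 occurs *)
      forall k j : nat, (k <= 1)%N -> (1 <= j <= n - 2)%N ->
        zelim R[i] n k j != 0,
      ftor_expr R[i] n (n - 3) = identify (- Rb R[i] (n - 1)),
      ftor_expr R[i] n (n - 2) =
        identify (qq1 R[i] * Rsigma R[i] (n - 1)
                  + (xx R[i] - qq1 R[i]) * Rb R[i] (n - 1)
                  - qq1 R[i] * qq2 R[i])
        - ftor_cofactor R[i] n * ftor_expr R[i] n (n - 3)
    & exists g1 g2 : laurent R[i] 4,
      [/\ laurent_val g1 = ftor_expr R[i] n (n - 3),
          laurent_val g2 = ftor_expr R[i] n (n - 2)
            + ftor_cofactor R[i] n * ftor_expr R[i] n (n - 3)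
        & exists phi : {rmorphism quot2 g1 g2 ->
              quot2 (lpoly (Rb R[i] (n - 1)))
                    (lpoly (Rsigma R[i] (n - 1) - qq2 R[i]))},
          [/\ bijective phi,
              forall c : R[i],
                phi (quot2_pi g1 g2 (lpoly c%:MP)) = quot2_pi _ _ (lpoly c%:MP),
              (* z_{0,1} = h, z_{1,1} = q1 x *)
              phi (quot2_pi g1 g2 (lpoly (var4 R[i] 0)))
                = quot2_pi _ _ (lpoly (hh R[i])),
              phi (quot2_pi g1 g2 (lpoly (var4 R[i] 1)))
                = quot2_pi _ _ (lpoly (qq1 R[i] * xx R[i]))
            & phi (quot2_pi g1 g2 (lpoly (var4 R[i] 2)))
                = quot2_pi _ _ (lpoly (qq1 R[i])) /\
              phi (quot2_pi g1 g2 (lpoly (var4 R[i] 3)))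
                = quot2_pi _ _ (lpoly (qq2 R[i]))]]].
Proof.
case: n hn => [|[|[|[|m]]]] // _; set F := R[i].
rewrite !subSS !subn0; set rbm := Rb F m.+3; set rsm := Rsigma F m.+3.
set e2 := qq1 F * rsm + (xx F - qq1 F) * rbm - qq1 F * qq2 F.
have E1 : ftor_expr F m.+4 m.+1 = identify (- rbm).
  by rewrite rmorphN /= /rbm identify_Rb ftor_expr_penult.
have E2 : ftor_expr F m.+4 m.+2
    = identify e2 - ftor_cofactor F m.+4 * ftor_expr F m.+4 m.+1.
  rewrite ftor_expr_last /e2 rmorphB rmorphD !rmorphM rmorphB /= /rbm /rsm.
  by rewrite identify_Rb identify_Rsigma !identify_var.
split=> //; first by move=> k j _ hj; apply: zelim_neq0; rewrite !subSS subn0.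
(* The generators are pulled back from the h, x side; by E2 the second one is the second expression
   with the multiple of the first restored. *)
pose g1 := to_z F (lpoly (- rbm)); pose g2 := to_z F (lpoly e2).
exists g1, g2; split; rewrite ?laurent_val_to_z //; first by rewrite E2 subrK.
have [||||phi [phi_bij phiE]] := quot2_iso (a1 := g1) (a2 := g2)
  (b1 := lpoly rbm) (b2 := lpoly (rsm - qq2 F)) (@to_hxK F) (@to_zK F).
- rewrite to_zK; apply: (@ideal2P _ _ _ (-1) 0).
  by rewrite rmorphN mulN1r mul0r addr0.
(* The witnesses come from e2 = (x - q1) R_b + q1 (R_sigma - q2). *)
- rewrite to_zK; apply: (@ideal2P _ _ _ (lpoly (xx F - qq1 F)) (lpoly (qq1 F))).
  by rewrite -!rmorphM -rmorphD; congr lpoly; rewrite /e2; ring.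
- apply: (@ideal2P _ _ _ (-1) 0).
  by rewrite /g1 !rmorphN mulN1r opprK mul0r addr0.
(* The same relation solved for R_sigma - q2, which is possible because q1 is a unit; the sign in g1
   = - R_b accounts for the coefficient (x - q1) / q1. *)
- apply: (@ideal2P _ _ _ (to_z F (lvarV F 2 * lpoly (xx F - qq1 F)))
    (to_z F (lvarV F 2))).
  rewrite -!rmorphM -rmorphD; congr (to_z F _).
  rewrite -mulrA -mulrDr -rmorphM -rmorphD.
  have -> : (xx F - qq1 F) * - rbm + e2 = qq1 F * (rsm - qq2 F) by rewrite /e2; ring.
  by rewrite rmorphM mulrA [lvarV F 2 * _]mulrC lvarK mul1r.
exists phi; split=> //; first by move=> c; rewrite phiE /= lsubstC.
- by rewrite phiE (to_hx_var F (k := 0)).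
- by rewrite phiE (to_hx_var F (k := 1)) // rmorphM.
- by rewrite !phiE (to_hx_var F (k := 2)) // (to_hx_var F (k := 3)).
Qed.
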